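(* Let $p=2n+1\ge 3$ be an odd integer and let $P=A_0A_1\cdots A_{p-1}$ be a $p$-gon of density $q$ inscribed in and circumscribed about a pair of homothetic ellipses with common center $O$ (inscribed in one and circumscribed about the other), whose inellipse (the one about which $P$ is circumscribed) has semi-axes of lengths $\alpha$ and $\beta$. Let $M_k$ denote the midpoint of the side $\overline{A_{n+k}A_{n+k+1}}$ (indices modulo $p$). Then $$\sum_{k=0}^{p-1}|OM_k|^2=\frac{p}{2}(\alpha^2+\beta^2).$$
   Context: All objects lie in the Euclidean plane. A $p$-gon $A_0A_1\cdots A_{p-1}$ is a cyclically ordered sequence of $p$ distinct points (vertices), with sides $\overline{A_kA_{k+1}}$ (indices modulo $p$); it may be self-crossing. It is inscribed in an ellipse if all its vertices lie on the ellipse, and circumscribed about an ellipse if every line $A_kA_{k+1}$ is tangent to the ellipse. Two ellipses with common center $O$ are homothetic if one is the image of the other under a homothety centered at $O$; circles are allowed as ellipses. Density: for coprime positive integers $p,q$ with $1\le q\le\lfloor p/2\rfloor$, the regular polygon $\{p/q\}$ has vertices obtained by successive rotations of a vertex about the center through the angle $2q\pi/p$. A $p$-gon has density $q$ if its vertices are connected according to the same cyclic ordering as $\{p/q\}$: that is, if $V_0,V_1,\dots,V_{p-1}$ are its vertices listed in cyclic order around the outer ellipse (in a suitable one of the two directions, starting at $V_0=A_0$), then $A_k=V_{qk \bmod p}$ for all $k$. *)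

(* Defs.v *)
From HB Require Import structures.
From mathcomp Require Import all_boot all_order all_algebra.
From mathcomp Require Import all_classical all_reals all_analysis.

Set Implicit Arguments.
Unset Strict Implicit.
Unset Printing Implicit Defensive.

Import Order.TTheory GRing.Theory Num.Theory.
Local Open Scope classical_set_scope.
Local Open Scope ring_scope.

(* The library norm on 'rV[R]_2 is the sup norm, hence the explicit Euclidean
   structure below. *)
Definition dot (R : realType) (x y : 'rV[R]_2) : R :=
  \sum_(i < 2) x 0 i * y 0 i.

Definition eucl_dist (R : realType) (x y : 'rV[R]_2) : R :=
  Num.sqrt (dot (x - y) (x - y)).

Definition segment_midpoint (R : realType) (x y : 'rV[R]_2) : 'rV[R]_2 :=
  2^-1 *: (x + y).

Definition line (R : realType) (x y : 'rV[R]_2) : set 'rV[R]_2 :=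
  range (fun s : R => x + s *: (y - x)).

Definition homothety (R : realType) (o : 'rV[R]_2) (r : R) (x : 'rV[R]_2) :
  'rV[R]_2 := o + r *: (x - o).

(* Either orientation of the frame is allowed. *)
Definition orthonormal_frame (R : realType) (u v : 'rV[R]_2) : Prop :=
  [/\ dot u u = 1, dot v v = 1 & dot u v = 0].

(* The point of eccentric angle t on the ellipse with center o, semi-axes of
   lengths a and b, and axes directed by u and v. *)
Definition ellipse_point (R : realType) (o u v : 'rV[R]_2) (a b t : R) :
  'rV[R]_2 := o + (a * cos t) *: u + (b * sin t) *: v.

Definition ellipse (R : realType) (o u v : 'rV[R]_2) (a b : R) :
  set 'rV[R]_2 := range (ellipse_point o u v a b).

(* Tangency to an ellipse: exactly one common point. *)
Definition tangent (R : realType) (l E : set 'rV[R]_2) : Prop :=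
  exists! x, (l `&` E) x.

(* A polygon with m.+1 vertices is an injective family indexed by 'I_m.+1;
   [inZp i] is the index i taken modulo m.+1. *)
Definition inscribed (R : realType) (m : nat) (A : 'I_m.+1 -> 'rV[R]_2)
  (E : set 'rV[R]_2) : Prop := forall k, E (A k).

Definition circumscribed (R : realType) (m : nat) (A : 'I_m.+1 -> 'rV[R]_2)
  (E : set 'rV[R]_2) : Prop :=
  forall k : 'I_m.+1, tangent (line (A k) (A (inZp k.+1))) E.

(* The V j are met in this order during one turn of the 2 pi-periodic simple
   closed curve g. *)
Definition met_in_order (R : realType) (g : R -> 'rV[R]_2) (m : nat)
  (V : 'I_m.+1 -> 'rV[R]_2) : Prop :=
  exists t : 'I_m.+1 -> R,
    [/\ forall i j : 'I_m.+1, (i < j)%N -> t i < t j,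
        t ord_max < t ord0 + 2 * pi
      & forall j, V j = g (t j)].

Definition cyclically_ordered (R : realType) (g : R -> 'rV[R]_2) (m : nat)
  (V : 'I_m.+1 -> 'rV[R]_2) : Prop :=
  met_in_order g V \/ met_in_order (fun s => g (- s)) V.

(* g is a 2 pi-periodic parametrization of the outer ellipse. *)
Definition has_density (R : realType) (g : R -> 'rV[R]_2) (m : nat)
  (A : 'I_m.+1 -> 'rV[R]_2) (q : nat) : Prop :=
  [/\ coprime m.+1 q, (1 <= q <= m.+1./2)%N
    & exists V : 'I_m.+1 -> 'rV[R]_2,
        [/\ V ord0 = A ord0, cyclically_ordered g V
          & forall k : 'I_m.+1, A k = V (inZp (q * k))]].

(* Main.v *)
Require Import Defs.
From HB Require Import structures.
From mathcomp Require Import all_boot all_order all_algebra.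
From mathcomp Require Import all_classical all_reals all_analysis.
From mathcomp Require Import ring lra.

(** The linear map that turns the inellipse into the unit circle about O turns
the outer ellipse into the concentric circle of radius |r|, and the vertices
into points r w_k with w_k a unit vector.  A line through two points of the
outer circle is tangent to the unit circle only at the midpoint of the chord,
because the half-turn of the chord about its midpoint preserves the distance
to O ([tangent_chord_midpoint]).  Hence every chord has the same inner product
c = w_k . w_(k+1) = 2 / r^2 - 1.

With M the midpoint of a side, the image of M has coordinates (X, Y) with
X^2 + Y^2 = 1, while |OM|^2 = alpha^2 X^2 + beta^2 Y^2.  It is thus enough
that the sum of X^2 - Y^2 over the sides vanishes.  In complex notation
X^2 - Y^2 is r^2 / 4 times the real part of (w_k + w_(k+1))^2, so it suffices
that T = sum w_k^2 and S = sum w_k w_(k+1) have zero real parts.  Two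
identities relate them:
- for each side, w_k^2 + w_(k+1)^2 = 2 c w_k w_(k+1), whence T = c S;
- at each vertex, w_k + w_(k+2) = 2 c w_(k+1), since w_k and w_(k+2) are the
  two distinct unit vectors with inner product c with w_(k+1); multiplying by
  w_(k+1) and summing gives S = c T.
So T = c^2 T, and c^2 <> 1 because consecutive vertices are distinct and r is
finite; this is [sum_re_square_unit_cycle]. *)

Set Implicit Arguments.
Unset Strict Implicit.
Unset Printing Implicit Defensive.

Import Order.TTheory GRing.Theory Num.Theory.
Local Open Scope classical_set_scope.
Local Open Scope ring_scope.

(** Both vectors have coordinate c along (x, y), hence opposite or equal
coordinates along the orthogonal direction. *)
Lemma unit_vectors_same_inner (F : fieldType) (c x y x1 y1 x2 y2 : F) :
  x ^+ 2 + y ^+ 2 = 1 -> x1 ^+ 2 + y1 ^+ 2 = 1 -> x2 ^+ 2 + y2 ^+ 2 = 1 ->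
  x * x1 + y * y1 = c -> x * x2 + y * y2 = c ->
  (x1 = x2 /\ y1 = y2) \/
  (x1 + x2 = 2 * c * x /\ y1 + y2 = 2 * c * y).
Proof.
move=> h h1 h2 e1 e2.
pose s1 := x * y1 - y * x1; pose s2 := x * y2 - y * x2.
have decomp a b : a = (x * a + y * b) * x - (x * b - y * a) * y /\
                  b = (x * a + y * b) * y + (x * b - y * a) * x.
  by split; rewrite -[LHS]mulr1 -h; ring.
have lagrange a b :
    (x * a + y * b) ^+ 2 + (x * b - y * a) ^+ 2 = a ^+ 2 + b ^+ 2.
  by rewrite -[RHS]mul1r -h; ring.
have /eqP : s1 ^+ 2 = s2 ^+ 2.
  apply: (addrI (c ^+ 2)).
  by rewrite /s1 /s2 -{1}e1 -{1}e2 !lagrange h1 h2.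
have [X1 Y1] := decomp x1 y1; have [X2 Y2] := decomp x2 y2.
rewrite e1 -/s1 in X1 Y1; rewrite e2 -/s2 in X2 Y2.
rewrite eqf_sqr => /orP[] /eqP E; [left|right].
  by rewrite X1 Y1 X2 Y2 E.
by rewrite X1 Y1 X2 Y2 E; split; ring.
Qed.

Lemma sum_ordS (V : nmodType) (m : nat) (f : 'I_m -> V) :
  \sum_k f (ordS k) = \sum_k f k.
Proof. by rewrite [RHS](reindex_inj (@ordS_inj m)). Qed.

(** The two sums are the real parts of T and S; T = c S and S = c T. *)
Lemma sum_re_square_unit_cycle (R : realFieldType) (m : nat) (c : R)
    (x y : 'I_m -> R) :
  (forall k, x k ^+ 2 + y k ^+ 2 = 1) ->
  (forall k, x k * x (ordS k) + y k * y (ordS k) = c) ->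
  (forall k, ~ (x k = x (ordS (ordS k)) /\ y k = y (ordS (ordS k)))) ->
  c ^+ 2 != 1 ->
  \sum_k (x k ^+ 2 - y k ^+ 2) = 0 /\
  \sum_k (x k * x (ordS k) - y k * y (ordS k)) = 0.
Proof.
move=> unit_xy inner_c nback c2.
set T := \sum_k (x k ^+ 2 - y k ^+ 2); set S := \sum_k (_ * _ - _).
have sides : T + T = 2 * c * S.
  rewrite {2}/T -(sum_ordS (fun k => x k ^+ 2 - y k ^+ 2)) -big_split mulr_sumr.
  apply: eq_bigr => k _ /=.
  have h k' : x k' ^+ 2 = 1 - y k' ^+ 2 by rewrite -(unit_xy k') addrK.
  rewrite -(inner_c k).
  transitivity (2 * (x k ^+ 2 * x (ordS k) ^+ 2 - y k ^+ 2 * y (ordS k) ^+ 2)).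
    by rewrite !h; ring.
  by ring.
have vertices : S + S = 2 * c * T.
  rewrite {2}/S.
  rewrite -(sum_ordS (fun k => x k * x (ordS k) - y k * y (ordS k))).
  rewrite -big_split /T mulr_sumr.
  rewrite -(sum_ordS (fun k => 2 * c * (x k ^+ 2 - y k ^+ 2))).
  apply: eq_bigr => k _ /=.
  have h0 : x (ordS k) * x k + y (ordS k) * y k = c.
    by rewrite -(inner_c k); ring.
  have [/nback //|[ex ey]] := unit_vectors_same_inner (unit_xy (ordS k))
    (unit_xy k) (unit_xy (ordS (ordS k))) h0 (inner_c (ordS k)).
  transitivity (x (ordS k) * (x k + x (ordS (ordS k)))
              - y (ordS k) * (y k + y (ordS (ordS k)))); first by ring.
  by rewrite ex ey; ring.
have TcS : T = c * S by lra.
have ScT : S = c * T by lra.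
have T0 : T = 0.
  apply/eqP; have /eqP : (c ^+ 2 - 1) * T = 0.
    by rewrite mulrBl mul1r expr2 -mulrA -ScT -TcS subrr.
  by rewrite mulf_eq0 subr_eq0 (negbTE c2).
by rewrite ScT T0 mulr0.
Qed.

(** Affine coordinates in which the ellipse is the unit circle. *)
Definition frame_point (R : realType) (o u v : 'rV[R]_2) (a b x y : R) :
  'rV[R]_2 := o + (a * x) *: u + (b * y) *: v.

Section FramePoint.
Variables (R : realType) (o u v : 'rV[R]_2) (a b : R).
Hypotheses (huv : orthonormal_frame u v) (a_gt0 : 0 < a) (b_gt0 : 0 < b).

Local Notation P := (frame_point o u v a b).

Lemma dot_frame (s t : R) :
  dot (s *: u + t *: v) (s *: u + t *: v) = s ^+ 2 + t ^+ 2.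
Proof.
have [uu vv uv] := huv.
transitivity (s ^+ 2 * dot u u + t ^+ 2 * dot v v + 2 * s * t * dot u v).
  by rewrite /dot !big_ord_recl !big_ord0 !mxE; ring.
by rewrite uu vv uv; ring.
Qed.

Lemma frame_point_inj (x y x' y' : R) :
  P x y = P x' y' -> x = x' /\ y = y'.
Proof.
move=> e.
have := dot_frame (a * (x - x')) (b * (y - y')).
have -> : (a * (x - x')) *: u + (b * (y - y')) *: v = P x y - P x' y'.
  by apply/rowP => i; rewrite !mxE; ring.
rewrite e subrr /dot big1 => [/esym/eqP|i _]; last by rewrite mxE mul0r.
rewrite paddr_eq0 ?sqr_ge0 // !sqrf_eq0 !mulf_eq0 !subr_eq0.
by rewrite (gt_eqF a_gt0) (gt_eqF b_gt0) => /andP[/eqP-> /eqP->].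
Qed.

Lemma mem_ellipse_frame_point (x y : R) :
  ellipse o u v a b (P x y) <-> x ^+ 2 + y ^+ 2 = 1.
Proof.
split=> [[t _ /frame_point_inj[<- <-]]|xy1]; first exact: cos2Dsin2.
have x1 : -1 <= x <= 1 by apply/andP; have := sqr_ge0 y; split; nra.
have sx : `|y| = Num.sqrt (1 - x ^+ 2).
  by rewrite -xy1 addrAC subrr add0r sqrtr_sqr.
have [y0|y0] := leP 0 y.
  exists (acos x) => //; rewrite /ellipse_point acosK ?sin_acos //.
  by rewrite -sx ger0_norm.
exists (- acos x) => //; rewrite /ellipse_point cosN sinN acosK ?sin_acos //.
by rewrite -sx ltr0_norm // opprK.
Qed.

Lemma homothety_frame_point (r x y : R) :
  homothety o r (P x y) = P (r * x) (r * y).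
Proof. by apply/rowP => i; rewrite !mxE; ring. Qed.

Lemma segment_midpoint_frame_point (x y x' y' : R) :
  segment_midpoint (P x y) (P x' y') = P ((x + x') / 2) ((y + y') / 2).
Proof. by apply/rowP => i; rewrite !mxE; field. Qed.

Lemma eucl_dist_frame_point (x y : R) :
  eucl_dist o (P x y) ^+ 2 = (a * x) ^+ 2 + (b * y) ^+ 2.
Proof.
rewrite /eucl_dist.
have -> : o - P x y = (- (a * x)) *: u + (- (b * y)) *: v.
  by apply/rowP => i; rewrite !mxE; ring.
by rewrite dot_frame !sqrrN sqr_sqrtr // addr_ge0 // sqr_ge0.
Qed.

(** The chord is symmetric about its midpoint: if the parameter s gives a
common point of the line and the ellipse, so does 1 - s, and uniqueness forces
s = 1/2. *)
Lemma tangent_chord_midpoint (x y x' y' : R) :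
  x ^+ 2 + y ^+ 2 = x' ^+ 2 + y' ^+ 2 -> ~ (x = x' /\ y = y') ->
  tangent (line (P x y) (P x' y')) (ellipse o u v a b) ->
  ((x + x') / 2) ^+ 2 + ((y + y') / 2) ^+ 2 = 1.
Proof.
move=> same_norm neq [_ [[[s _ <-] on_ell] uniq_pt]].
have lineE t : P x y + t *: (P x' y' - P x y) =
               P (x + t * (x' - x)) (y + t * (y' - y)).
  by apply/rowP => i; rewrite !mxE; ring.
rewrite lineE mem_ellipse_frame_point in on_ell.
have on_ell' :
    (x + (1 - s) * (x' - x)) ^+ 2 + (y + (1 - s) * (y' - y)) ^+ 2 = 1.
  rewrite -[RHS]on_ell; apply/eqP; rewrite -subr_eq0; apply/eqP.
  transitivity ((1 - 2 * s) * (x' ^+ 2 + y' ^+ 2 - (x ^+ 2 + y ^+ 2))).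
    by ring.
  by rewrite same_norm subrr mulr0.
have /uniq_pt : (line (P x y) (P x' y') `&` ellipse o u v a b)
    (P (x + (1 - s) * (x' - x)) (y + (1 - s) * (y' - y))).
  split; last exact/mem_ellipse_frame_point.
  by exists (1 - s) => //; rewrite lineE.
rewrite lineE => /frame_point_inj[ex ey].
have half : s = 2^-1.
  have fx : (2 * s - 1) * (x' - x) = 0 by lra.
  have fy : (2 * s - 1) * (y' - y) = 0 by lra.
  have [d0|d0] := eqVneq (2 * s - 1) 0; first by lra.
  case: neq; split; apply/eqP; rewrite eq_sym -subr_eq0.
    by move/eqP: fx; rewrite mulf_eq0 (negbTE d0).
  by move/eqP: fy; rewrite mulf_eq0 (negbTE d0).
by rewrite -[RHS]on_ell half; field.
Qed.

End FramePoint.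

Lemma inZp_ordS (m i : nat) : inZp i.+1 = ordS (inZp i : 'I_m.+1).
Proof. by apply: val_inj; rewrite /= -addn1 -modnDml addn1. Qed.

Lemma ordS2_neq (m : nat) (k : 'I_m.+1) : (3 <= m.+1)%N -> ordS (ordS k) != k.
Proof.
move=> m3; apply/eqP => /(congr1 val) /= /eqP.
rewrite -addn1 modnDml addn1 -[in X in _ == X](modn_small (ltn_ord k)).
by rewrite -addn2 -[X in _ == X %[mod _]]addn0 eqn_modDl mod0n modn_small.
Qed.

Lemma ordS_neq (m : nat) (k : 'I_m.+1) : (2 <= m.+1)%N -> ordS k != k.
Proof.
move=> m2; apply/eqP => /(congr1 val) /= /eqP.
rewrite -[in X in _ == X](modn_small (ltn_ord k)).
by rewrite -addn1 -[X in _ == X %[mod _]]addn0 eqn_modDl mod0n modn_small.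
Qed.

Theorem corollary2 (R : realType) (n q : nat) (hn : (3 <= (2 * n).+1)%N)
  (O u v : 'rV[R]_2) (alpha beta r : R)
  (huv : orthonormal_frame u v) (halpha : 0 < alpha) (hbeta : 0 < beta)
  (hr : r != 0)
  (A : 'I_(2 * n).+1 -> 'rV[R]_2) (hA : injective A)
  (hin : inscribed A (homothety O r @` ellipse O u v alpha beta))
  (hcirc : circumscribed A (ellipse O u v alpha beta))
  (hq : has_density
          (fun t => homothety O r (ellipse_point O u v alpha beta t)) A q) :
  \sum_(k < (2 * n).+1)
     eucl_dist O (segment_midpoint (A (inZp (n + k))) (A (inZp (n + k).+1))) ^+ 2
  = (2 * n).+1%:R / 2 * (alpha ^+ 2 + beta ^+ 2).
Proof.
pose f k := eucl_dist O (segment_midpoint (A k) (A (ordS k))) ^+ 2.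
have shift_inj :
    injective (fun k : 'I_(2 * n).+1 => inZp (n + k) : 'I_(2 * n).+1).
  move=> i j /(congr1 val) /= /eqP; rewrite eqn_modDl.
  by rewrite !modn_small // => /eqP /val_inj.
transitivity (\sum_k f k).
  rewrite [RHS](reindex_inj shift_inj).
  by apply: eq_bigr => k _; rewrite inZp_ordS.
have angle k : {t | A k = frame_point O u v alpha beta (r * cos t) (r * sin t)}.
  apply: cid; have [_ [t _ <-] <-] := hin k.
  by exists t; rewrite -homothety_frame_point.
pose x k := cos (projT1 (angle k)); pose y k := sin (projT1 (angle k)).
have AE k : A k = frame_point O u v alpha beta (r * x k) (r * y k).
  exact: (projT2 (angle k)).
have unit_xy k : x k ^+ 2 + y k ^+ 2 = 1 by exact: cos2Dsin2.
have neq i j : i != j -> ~ (x i = x j /\ y i = y j).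
  by move=> /eqP ij [ex ey]; apply: ij; apply: hA; rewrite !AE ex ey.
have neqS k : ~ (x k = x (ordS k) /\ y k = y (ordS k)).
  by apply: neq; rewrite eq_sym; apply: ordS_neq; exact: ltnW.
have midpoint_unit k :
    r ^+ 2 / 4 * ((x k + x (ordS k)) ^+ 2 + (y k + y (ordS k)) ^+ 2) = 1.
  have := hcirc k; rewrite inZp_ordS valZpK !AE.
  move=> /(tangent_chord_midpoint huv halpha hbeta) H; rewrite -[RHS]H.
  - by field.
  - by rewrite !exprMn -!mulrDr !unit_xy.
  - by move=> [/(mulfI hr) ex /(mulfI hr) ey]; apply: (neqS k).
pose c := 2 / r ^+ 2 - 1.
have inner_c k : x k * x (ordS k) + y k * y (ordS k) = c.
  have r2 : r ^+ 2 != 0 by rewrite sqrf_eq0.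
  apply: (mulfI r2); rewrite /c mulrBr mulrCA divff // !mulr1.
  have : r ^+ 2 / 4 * (x k ^+ 2 + y k ^+ 2 + (x (ordS k) ^+ 2 + y (ordS k) ^+ 2)
      + 2 * (x k * x (ordS k) + y k * y (ordS k))) = 1.
    by rewrite -[RHS](midpoint_unit k); ring.
  by rewrite !unit_xy; lra.
have c2 : c ^+ 2 != 1.
  rewrite sqrf_eq1 negb_or; apply/andP; split; apply/eqP => c1; last first.
    (* c = -1 would put the midpoints at O *)
    have : r ^- 2 != 0 by rewrite invr_eq0 sqrf_eq0.
    by move/eqP; apply; move: c1; rewrite /c; lra.
  (* c = 1 would make consecutive vertices coincide *)
  apply: (neqS ord0).
  have := inner_c ord0; have := unit_xy ord0; have := unit_xy (ordS ord0).
  rewrite c1 => h1 h2 h3.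
  have /eqP : (x ord0 - x (ordS ord0)) ^+ 2 + (y ord0 - y (ordS ord0)) ^+ 2 = 0.
    lra.
  rewrite paddr_eq0 ?sqr_ge0 // !sqrf_eq0 !subr_eq0.
  by move=> /andP[/eqP-> /eqP->].
have [T0 S0] : \sum_k (x k ^+ 2 - y k ^+ 2) = 0 /\
    \sum_k (x k * x (ordS k) - y k * y (ordS k)) = 0.
  apply: (sum_re_square_unit_cycle unit_xy inner_c _ c2) => k.
  by apply: neq; rewrite eq_sym; apply: ordS2_neq.
pose h := (alpha ^+ 2 - beta ^+ 2) * (r ^+ 2 / 8).
(* alpha^2 X^2 + beta^2 Y^2 is split into its parts along X^2 + Y^2 = 1 and
   X^2 - Y^2. *)
have fE k : f k = (alpha ^+ 2 + beta ^+ 2) / 2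
    + (h * (x k ^+ 2 - y k ^+ 2) + h * (x (ordS k) ^+ 2 - y (ordS k) ^+ 2)
       + 2 * h * (x k * x (ordS k) - y k * y (ordS k))).
  rewrite /f !AE segment_midpoint_frame_point eucl_dist_frame_point //.
  rewrite -[(alpha ^+ 2 + _) / 2]mulr1.
  by rewrite -[X in (alpha ^+ 2 + _) / 2 * X](midpoint_unit k) /h; field.
rewrite (eq_bigr _ (fun k _ => fE k)) !big_split /= -!mulr_sumr.
rewrite (sum_ordS (fun k => x k ^+ 2 - y k ^+ 2)) T0 S0 !mulr0 !addr0.
by rewrite sumr_const card_ord -mulr_natl; ring.
Qed.
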